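(* Let $G=\left(N,M,(A^i)_{i\in N},(\Xi_j)_{j\in M}\right)$ be a congestion game with $N=\{1,\dots,n\}$ and $M=\{1,\dots,m\}$. Then the payoff functions $c_i$ of $G$ satisfy $$c_i(a)=\Xi\, D(a)\, a^i,\qquad i=1,\dots,n,$$ for every profile $a\in A$, where $a^i$ on the right-hand side denotes the index (column) vector in $\mathbb{R}^m$ of player $i$'s strategy in $a$.
   Context: A congestion game is a tuple $(N,M,(A^i)_{i\in N},(\Xi_j)_{j\in M})$, where $N=\{1,\dots,n\}$ is the set of players, $M=\{1,\dots,m\}$ is the finite set of facilities, $A^i\subset 2^M$ is the strategy set of player $i$ (each strategy is a subset of $M$), and $\Xi_j:\mathbb{R}\to\mathbb{R}$ is the facility-cost function of facility $j$, whose value depends on the number of players using facility $j$. Profiles are $a=(a^1,\dots,a^n)\in A:=\prod_{i=1}^n A^i$. The number of users of facility $j$ is $r_j(a):=|\{i : j\in a^i\}|$. The payoff function of player $i$ is $$c_i(a):=\sum_{j\in a^i}\Xi_j(r_j(a)).$$ Vector notation: put $\xi^j_k:=\Xi_j(k)$ for $k=1,\dots,n$; identify $\Xi_j$ with the row vector $[\xi^j_1,\dots,\xi^j_n]$; and set $\Xi:=[\Xi_1,\Xi_2,\dots,\Xi_m]\in\mathbb{R}^{mn}$ (a row vector). A strategy $a^i\in 2^M$ is identified with the column vector in $\mathbb{R}^m$ whose $s$-th entry is $1$ if $s\in a^i$ and $0$ otherwise. Let $\delta_n^k$ be the $k$-th column of the identity matrix $I_n$ and $\mathbf{0}_n$ the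 zero column vector in $\mathbb{R}^n$. For $j=1,\dots,m$ let $d_j(a):=\delta_n^{r_j(a)}$ if $r_j(a)\neq 0$ and $d_j(a):=\mathbf{0}_n$ otherwise. Let $D(a):=\mathrm{diag}(d_1(a),\dots,d_m(a))$ be the $mn\times m$ block-diagonal matrix whose $j$-th diagonal block is the $n\times 1$ column $d_j(a)$. *)

(* Defs.v *)
From mathcomp Require Import all_boot all_order all_algebra.
From mathcomp Require Import reals.

Set Implicit Arguments.
Unset Strict Implicit.
Unset Printing Implicit Defensive.

Import GRing.Theory.

Local Open Scope ring_scope.

(* The players 1..n and the facilities 1..m are 'I_n and 'I_m, numbered from 0. *)
Record congestion_game (R : realType) (n m : nat) := CongestionGame {
  strategies : 'I_n -> {set {set 'I_m}};
  facility_cost : 'I_m -> R -> R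
}.

Section Definitions.

Variables (R : realType) (n m : nat).
Implicit Types (G : congestion_game R n m) (a : {ffun 'I_n -> {set 'I_m}}).

(* a \in profiles G iff a i \in strategies G i for every player i. *)
Definition profiles G : {pred {ffun 'I_n -> {set 'I_m}}} :=
  family (strategies G).

Definition users a (j : 'I_m) : nat := #|[set i | j \in a i]|.

Definition payoff G a (i : 'I_n) : R :=
  \sum_(j in a i) facility_cost G j (users a j)%:R.

Definition cost_row G (j : 'I_m) : 'rV[R]_n :=
  \row_(k < n) facility_cost G j k.+1%:R.

(* mxrow and mxblock produce dimensions of the form \sum_(j < m) n; the two
   equations below cast them to m * n and m. *)
Lemma sum_cst_ord : (\sum_(j < m) n = m * n)%N.
Proof. by rewrite sum_nat_const card_ord. Qed.

Lemma sum_one_ord : (\sum_(j < m) 1 = m)%N.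
Proof. by rewrite sum1_card card_ord. Qed.

Definition cost_vector G : 'rV[R]_(m * n) :=
  castmx (erefl, sum_cst_ord) (\mxrow_(j < m) cost_row G j).

Definition strategy_vector (s : {set 'I_m}) : 'cV[R]_m :=
  \col_(j < m) (j \in s)%:R.

(* The k-th column of the identity matrix, with k counted from 1; it is meant
   for 1 <= k <= n, and the default value is taken only when k.-1 >= n. *)
Definition delta_col (k : nat) : 'cV[R]_n :=
  oapp (fun i : 'I_n => col i 1%:M) 0 (insub k.-1).

Definition users_col a (j : 'I_m) : 'cV[R]_n :=
  if users a j != 0%N then delta_col (users a j) else 0.

(* mxdiag only accepts square blocks, hence the explicit off-diagonal zeros. *)
Definition users_mx a : 'M[R]_(m * n, m) :=
  castmx (sum_cst_ord, sum_one_ord)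
    (\mxblock_(j < m, l < m) (if j == l then users_col a j else 0)).

End Definitions.

(* Main.v *)
Require Import Defs.
From mathcomp Require Import all_boot all_order all_algebra.
From mathcomp Require Import reals.

Import GRing.Theory.

Local Open Scope ring_scope.

(** The product of [cost_vector] and [users_mx] is computed blockwise: the
    matrix is block diagonal, so the [j]-th block of the product is the cost
    row of facility [j] times a column that selects its entry number
    [users a j].  As that block has width 1, entry [j] of the product is the
    cost that each user of [j] pays (and 0 when nobody uses [j]).  Multiplying
    by the indicator vector of [a i] adds up these costs over the facilities
    that player [i] uses, and each of those has at least one user, namely [i],
    so that the selecting column is a genuine column of the identity.
    The blockwise product is [cost_vector_users_mxE] and the selection is
    [cost_row_delta_col]. *)

Lemma castmx_mulmx (R : pzSemiRingType) (p q q' r r' : nat) (eq_q : q = q')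
    (eq_r : r = r') (A : 'M[R]_(p, q)) (B : 'M[R]_(q, r)) :
  castmx (erefl, eq_q) A *m castmx (eq_q, eq_r) B =
  castmx (erefl, eq_r) (A *m B).
Proof. by case: _ / eq_q; case: _ / eq_r; rewrite !castmx_id. Qed.

(** Blocks of width 1 are laid out so that block [l] occupies exactly column
    [l], since the [l] blocks before it have total width [l]. *)
Lemma cast_mxrow_width1E (T : Type) (p m : nat)
    (eq_m : (\sum_(j < m) 1 = m)%N) (W : 'I_m -> 'cV[T]_p)
    (i : 'I_p) (l : 'I_m) :
  castmx (erefl, eq_m) (\mxrow_(j < m) W j) i l = W l i 0.
Proof.
have def_l : l = cast_ord eq_m (tagnat.Rank l (0 : 'I_1)).
  apply: val_inj; rewrite [RHS]tagnat.RankEsum addn0.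
  by rewrite (big_ord_narrow (ltnW (ltn_ord l))) sum1_card card_ord.
by rewrite {1}def_l castmxE cast_ord_id cast_ordK mxE ord1 tagnat.Rank1K.
Qed.

(** Within the range [0 < k <= n] the default value of [delta_col] is not
    reached; the shift [i.+1] is there because rows are numbered from 0. *)
Lemma delta_colE (R : realType) (n k : nat) (i : 'I_n) :
  (0 < k <= n)%N -> delta_col R n k i 0 = (i.+1 == k)%:R.
Proof.
case: k => // k /= lt_kn; rewrite /delta_col /= insubT /= !mxE.
by rewrite eqSS -val_eqE.
Qed.

Lemma users_gt0 (n m : nat) (a : {ffun 'I_n -> {set 'I_m}}) (i : 'I_n)
    (j : 'I_m) :
  j \in a i -> (0 < users a j)%N.
Proof. by move=> aij; apply/card_gt0P; exists i; rewrite inE. Qed.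

Lemma users_le (n m : nat) (a : {ffun 'I_n -> {set 'I_m}}) (j : 'I_m) :
  (users a j <= n)%N.
Proof. by rewrite -[leqRHS]card_ord max_card. Qed.

Lemma cost_row_delta_col (R : realType) (n m : nat)
    (G : congestion_game R n m) (j : 'I_m) (k : nat) :
  (0 < k <= n)%N ->
  (cost_row G j *m delta_col R n k) 0 0 = facility_cost G j k%:R.
Proof.
case: k => // k lt_kn; rewrite mxE (bigD1 (Ordinal lt_kn)) //= big1 => [|l nl].
  by rewrite delta_colE // mxE /= eqxx mulr1 addr0.
have /negPf l_neq_k : nat_of_ord l != k by rewrite -val_eqE in nl.
by rewrite delta_colE // eqSS l_neq_k mulr0.
Qed.

Lemma cost_vector_users_mxE (R : realType) (n m : nat)
    (G : congestion_game R n m) (a : {ffun 'I_n -> {set 'I_m}}) (j : 'I_m) :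
  (cost_vector G *m users_mx R a) 0 j = (cost_row G j *m users_col R a j) 0 0.
Proof.
rewrite castmx_mulmx mul_mxrow_mxblock cast_mxrow_width1E.
rewrite (bigD1 j) //= eqxx big1 ?addr0 // => l nl.
by rewrite (negPf nl) mulmx0.
Qed.

Theorem mainTheorem1 (R : realType) (n m : nat) (G : congestion_game R n m)
    (a : {ffun 'I_n -> {set 'I_m}}) (aA : a \in profiles G) (i : 'I_n) :
  (payoff G a i)%:M = cost_vector G *m users_mx R a *m strategy_vector R (a i).
Proof.
apply/matrixP=> x y; rewrite !ord1 mxE eqxx mulr1n mxE /payoff big_mkcond /=.
apply: eq_bigr => j _; rewrite [strategy_vector _ _ _ _]mxE.
case: ifPn => aij; last by rewrite mulr0.
have r_gt0 := users_gt0 _ _ _ _ _ aij.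
rewrite mulr1 cost_vector_users_mxE /users_col -lt0n r_gt0.
by rewrite cost_row_delta_col // r_gt0 users_le.
Qed.
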